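(* Let $R$ be a ring, $\Gamma$ an idempotent semiring, $\nu : R\to\Gamma$ a (nondegenerate) valuation, and $f\in R\langle x_1,\dots,x_n\rangle$ an expression. If $\vec{x}\in R^n$ satisfies $f(\vec{x})=0$, then the pointwise valuation $\nu(\vec{x})=(\nu(\vec x_1),\dots,\nu(\vec x_n))\in\Gamma^n$ is a crease point of $\operatorname{trop}_\nu(f)$.
   Context: Rings and semirings are unital and not necessarily commutative. A semiring is idempotent if $a+a=a$ for all $a$; it then carries the partial order $a\le b\iff a+b=a$. A valuation from a ring $R$ to an idempotent semiring $\Gamma$ is a function $\nu:R\to\Gamma$ with: $\nu(0)=0$ and $\nu(1)=1=\nu(-1)$; $\nu(ab)=\nu(a)\nu(b)$; and $\nu(a+b)\ge\nu(a)+\nu(b)$ (equivalently $\nu(a+b)+\nu(a)+\nu(b)=\nu(a)+\nu(b)$). It is nondegenerate if $\nu^{-1}(0_\Gamma)=\{0_R\}$. Convention: all valuations are nondegenerate. For a ring or semiring $S$, elements of $S\langle x_1,\dots,x_n\rangle$ are non-commutative polynomial expressions in which the variables are not assumed to commute with each other or with elements of $S$: finite sums $f=\sum_i m_i$ of monomials, each monomial being a word $m_i=s_0x_{j_1}s_1x_{j_2}\cdots x_{j_d}s_d$ with $s_k\in S$. Such an expression is evaluated at a vector in $S^n$ by substitution. Given $f=\sum_i m_i\in R\langle x_1,\dots,x_n\rangle$, its $\nu$-tropicalization $\operatorname{trop}_\nu(f)=\sum_i \operatorname{trop}_\nu(m_i)\in\Gamma\langle x_1,\dots,x_n\rangle$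 is the expression obtained by replacing every coefficient by its valuation; it is regarded as a sum of monomials indexed by the same index set as $f$. Given an expression $g=\sum_i m_i\in\Gamma\langle x_1,\dots,x_n\rangle$ written as a (finite, indexed) sum of monomials, a crease point of $g$ is a vector $\vec z\in\Gamma^n$ such that for every index $k$, $g(\vec z)=\sum_{i\neq k}m_i(\vec z)$ (an empty sum being $0_\Gamma$). *)

(* Defs.v *)
From mathcomp Require Import all_boot all_algebra.

Set Implicit Arguments.
Unset Strict Implicit.
Unset Printing Implicit Defensive.

Import GRing.Theory.
Local Open Scope ring_scope.

Definition idempotent_semiring (G : pzSemiRingType) : Prop :=
  forall a : G, a + a = a.

(* The min convention: addition is the infimum for [idem_le]. *)
Definition idem_le (G : pzSemiRingType) (a b : G) : Prop := a + b = a.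

Record valuation (R : pzRingType) (G : pzSemiRingType) (nu : R -> G) : Prop :=
  Valuation {
    val_0 : nu 0 = 0;
    val_1 : nu 1 = 1;
    val_N1 : nu (-1) = 1;
    val_M : forall a b : R, nu (a * b) = nu a * nu b;
    val_D : forall a b : R, idem_le (nu a + nu b) (nu (a + b))
  }.

Definition nondegenerate_val (R : pzRingType) (G : pzSemiRingType) (nu : R -> G)
  : Prop := forall a : R, nu a = 0 <-> a = 0.

(* The word s_0 x_(j_1) s_1 x_(j_2) ... x_(j_d) s_d is stored as s_0 together
   with the list of pairs (j_1, s_1), ..., (j_d, s_d). *)
Record ncmonomial (S : Type) (n : nat) := NCMonomial {
  mon_head : S;
  mon_tail : seq ('I_n * S)
}.

(* A formal finite indexed sum: monomials are neither merged nor identified,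
   even when they are equal as words or have a zero coefficient. *)
Record ncexpr (S : Type) (n : nat) := NCExpr {
  expr_index : finType;
  expr_mon : expr_index -> ncmonomial S n
}.

Definition eval_mon (S : pzSemiRingType) (n : nat) (m : ncmonomial S n)
    (z : 'rV[S]_n) : S :=
  mon_head m * \prod_(p <- mon_tail m) (z 0 p.1 * p.2).

Definition eval_expr (S : pzSemiRingType) (n : nat) (f : ncexpr S n)
    (z : 'rV[S]_n) : S :=
  \sum_(i : expr_index f) eval_mon (expr_mon i) z.

Definition trop_mon (R G : Type) (nu : R -> G) (n : nat) (m : ncmonomial R n)
  : ncmonomial G n :=
  NCMonomial (nu (mon_head m)) [seq (p.1, nu p.2) | p <- mon_tail m].

Definition trop (R G : Type) (nu : R -> G) (n : nat) (f : ncexpr R n)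
  : ncexpr G n :=
  NCExpr (fun i : expr_index f => trop_mon nu (expr_mon i)).

Definition crease_point (G : pzSemiRingType) (n : nat) (g : ncexpr G n)
    (z : 'rV[G]_n) : Prop :=
  forall k : expr_index g,
    eval_expr g z = \sum_(i : expr_index g | i != k) eval_mon (expr_mon i) z.

(* Main.v *)
Require Import Defs.
From mathcomp Require Import all_boot all_algebra.

Import GRing.Theory.
Local Open Scope ring_scope.

(** If the monomials of f sum to 0 at x, each one is minus the sum of the
    others, so its valuation is at least the sum of the other valuations and
    is absorbed by it. *)

(** [eval_trop_mon] turns the claim into one about valuations of elements of R, [valN] discards the
    minus sign, and [val_sum] is the absorption. *)

Lemma valN (R : pzRingType) (G : pzSemiRingType) (nu : R -> G)
    (hnu : valuation nu) (a : R) :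
  nu (- a) = nu a.
Proof. by rewrite -mulN1r (val_M hnu) (val_N1 hnu) mul1r. Qed.

Lemma val_sum (R : pzRingType) (G : pzSemiRingType) (nu : R -> G)
    (hnu : valuation nu) (I : Type) (r : seq I) (P : pred I) (F : I -> R) :
  idem_le (\sum_(i <- r | P i) nu (F i)) (nu (\sum_(i <- r | P i) F i)).
Proof.
apply: (big_rec2 (fun s t => idem_le s (nu t))) => [|i s t _ le_st].
  by rewrite /idem_le (val_0 hnu) addr0.
have := val_D hnu (F i) t; rewrite /idem_le in le_st * => le_it.
(* Since [s] absorbs [nu t], a copy of [nu t] can be placed beside [nu (F i)]; together they absorb
   [nu (F i + t)]. *)
by rewrite -le_st [s + _]addrC addrA [LHS]addrAC le_it.
Qed.

(** A monomial is a pure product, so multiplicativity carries [nu] through the word factor by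
    factor, with [val_1] for an empty tail. *)
Lemma eval_trop_mon (R : pzRingType) (G : pzSemiRingType) (nu : R -> G)
    (hnu : valuation nu) (n : nat) (m : ncmonomial R n) (x : 'rV[R]_n) :
  eval_mon (trop_mon nu m) (map_mx nu x) = nu (eval_mon m x).
Proof.
rewrite /eval_mon /= (val_M hnu) (big_morph nu (val_M hnu) (val_1 hnu)) big_map.
by congr (_ * _); apply: eq_bigr => p _; rewrite mxE (val_M hnu).
Qed.

Theorem theorem16 (R : pzRingType) (G : pzSemiRingType)
    (hG : idempotent_semiring G) (nu : R -> G)
    (hnu : valuation nu) (hnd : nondegenerate_val nu)
    (n : nat) (f : ncexpr R n) (x : 'rV[R]_n)
    (hx : eval_expr f x = 0) :
  crease_point (trop nu f) (map_mx nu x).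
Proof.
move=> /= k; rewrite /eval_expr (bigD1 k) //=.
under eq_bigr do rewrite eval_trop_mon //.
have mkE : eval_mon (@expr_mon R n f k) x
    = - \sum_(i : expr_index f | i != k) eval_mon (expr_mon i) x.
  by apply/eqP; rewrite -addr_eq0; move: hx; rewrite /eval_expr (bigD1 k) //= => ->.
(* What remains: the sum of the other valuations absorbs the valuation of the sum of the other
   monomials. *)
by rewrite eval_trop_mon // mkE valN // addrC val_sum.
Qed.
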